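(* Consider the $3$-torus $\mathbb{T}^3=\mathbb{R}^3/\mathbb{Z}^3$ with coordinates $(x,y,z)$, endowed with the Euclidean (flat) metric $g$, and let $\mathcal{F}$ be the linear foliation by planes $\mathcal{F}=\ker(dz-a\,dx-b\,dy)$, where $a,b\in\mathbb{R}$ are such that $1,a,b$ are linearly independent over $\mathbb{Q}$ (so that every leaf is a plane). Then the space of foliated cooriented contact elements $\mathbb{S}(T^*\mathcal{F})$, with its canonical leafwise contact form, has no closed Reeb orbits.
   Context: Let $\mathcal{F}$ be a foliation of a manifold $M$ and $g$ a (leafwise) Riemannian metric. Let $\pi:T^*\mathcal{F}\to M$ be the dual bundle of $T\mathcal{F}$, with the foliation $\mathcal{F}^*$ whose leaves are $\pi^{-1}(\mathcal{L})=T^*\mathcal{L}$ for $\mathcal{L}$ a leaf of $\mathcal{F}$. The canonical leafwise $1$-form is $\lambda_{(p,w)}(v)=w(d_{(p,w)}\pi(v))$ for $p\in M$, $w\in T_p^*\mathcal{F}$, and $v$ tangent to $\mathcal{F}^*$; on each leaf it is the Liouville form. The unit cotangent bundle $\mathbb{S}(T^*\mathcal{F})\subset T^*\mathcal{F}$ (for the metric dual to $g|_{T\mathcal{F}}$) carries the foliation with leaves $\mathbb{S}(T^*\mathcal{L})$, and the restriction of $\lambda$ to each leaf is a contact form. This is the space of foliated (co)oriented contact elements. Its Reeb vector field $R$ is the leafwise one: $R$ is tangent to the leaves $\mathbb{S}(T^*\mathcal{L})$, $\lambda(R)=1$, and $i_Rd\lambda=0$ along each leaf. *)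

(* Defs.v *)
From HB Require Import structures.
From mathcomp Require Import all_boot all_order all_algebra.
From mathcomp Require Import generic_quotient ring_quotient.
From mathcomp Require Import all_classical all_reals all_analysis.

Set Implicit Arguments.
Unset Strict Implicit.
Unset Printing Implicit Defensive.

Import Order.TTheory GRing.Theory Num.Theory.
Import numFieldNormedType.Exports.

Local Open Scope quotient_scope.
Local Open Scope classical_set_scope.
Local Open Scope ring_scope.

Definition Z3_lattice (R : realType) : {pred 'rV[R]_3} :=
  [pred v : 'rV[R]_3 | [forall i : 'I_3, v 0 i \is a Num.int]].

Fact Z3_lattice_zmod_closed (R : realType) : zmod_closed (@Z3_lattice R).
Proof.
split=> [|u v /forallP uZ /forallP vZ]; apply/forallP => i.
  by rewrite mxE rpred0.
by rewrite !mxE rpredB.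
Qed.

HB.instance Definition _ (R : realType) :=
  GRing.isZmodClosed.Build 'rV[R]_3 (@Z3_lattice R) (@Z3_lattice_zmod_closed R).

(* R^3 / Z^3 as a quotient group; its tangent bundle is trivialised by the
   translations, so a tangent vector at any point of it is a vector of R^3. *)
Definition torus (R : realType) : zmodType := Quotient.quot (@Z3_lattice R).

Definition torus_proj (R : realType) (x : 'rV[R]_3) : torus R :=
  \pi_(Quotient.quot (@Z3_lattice R)) x.

Definition euclid (R : realType) (u v : 'rV[R]_3) : R :=
  \sum_i u 0 i * v 0 i.

(* dx, dy, dz are [dcoord 0], [dcoord 1], [dcoord 2]. *)
Definition dcoord_fun (R : realType) (i : 'I_3) (v : 'rV[R]_3) : R^o := v 0 i.

Fact dcoord_fun_is_linear (R : realType) (i : 'I_3) : linear (@dcoord_fun R i).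
Proof. by move=> k u v; rewrite /dcoord_fun !mxE. Qed.

HB.instance Definition _ (R : realType) (i : 'I_3) :=
  GRing.isLinear.Build R 'rV[R]_3 R^o _ (@dcoord_fun R i)
    (@dcoord_fun_is_linear R i).

Definition dcoord (R : realType) (i : 'I_3) : 'Hom('rV[R]_3, R^o) :=
  linfun (@dcoord_fun R i).

(* The tangent distribution of the foliation; it is invariant under
   translations, hence the same subspace of R^3 at all points of the torus. *)
Definition TF (R : realType) (a b : R) : {vspace 'rV[R]_3} :=
  lker (dcoord R 2 - a *: dcoord R 0 - b *: dcoord R 1).

Definition tanF (R : realType) (a b : R) : vectType R := subvs_of (TF a b).
Definition cotF (R : realType) (a b : R) : vectType R := 'Hom(tanF a b, R^o).

Definition leaf (R : realType) (a b : R) (p : torus R) : set (torus R) :=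
  [set p + torus_proj (vsval v) | v in [set: tanF a b]].

Definition metricF (R : realType) (a b : R) (u v : tanF a b) : R^o :=
  euclid (vsval u) (vsval v).

Fact metricF_is_linear (R : realType) (a b : R) (u : tanF a b) :
  linear (metricF u).
Proof.
move=> k v w; rewrite /metricF linearP /euclid /=.
rewrite scaler_sumr -big_split /=; apply: eq_bigr => i _.
by rewrite !mxE mulrDr mulrCA.
Qed.

HB.instance Definition _ (R : realType) (a b : R) (u : tanF a b) :=
  GRing.isLinear.Build R (tanF a b) R^o _ (metricF u) (metricF_is_linear u).

Definition flat_fun (R : realType) (a b : R) (u : tanF a b) : cotF a b :=
  linfun (metricF u).

Fact flat_fun_is_linear (R : realType) (a b : R) : linear (@flat_fun R a b).
Proof.
move=> k u v; apply/lfunP => w; rewrite add_lfunE scale_lfunE !lfunE /=.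
rewrite /metricF linearP /euclid /= scaler_sumr -big_split /=.
by apply: eq_bigr => i _; rewrite !mxE mulrDl -mulrA.
Qed.

HB.instance Definition _ (R : realType) (a b : R) :=
  GRing.isLinear.Build R (tanF a b) (cotF a b) _ (@flat_fun R a b)
    (@flat_fun_is_linear R a b).

Definition flat (R : realType) (a b : R) : 'Hom(tanF a b, cotF a b) :=
  linfun (@flat_fun R a b).

(* [flat] is bijective since the metric is nondegenerate, so the right inverse
   (_^-1)%VF is its inverse. *)
Definition sharp (R : realType) (a b : R) : 'Hom(cotF a b, tanF a b) :=
  ((flat a b)^-1)%VF.

Definition dual_metric (R : realType) (a b : R) (w w' : cotF a b) : R :=
  metricF (sharp a b w) (sharp a b w').

(* Points (p, w) of T^*F, and leafwise tangent vectors (u, h) of T^*F: since TF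
   is constant, the vectors tangent to the leaf T^*L at (p, w) are the pairs of
   a vector u of T_pF and a covector h of T_p^*F. *)
Definition cotangent (R : realType) (a b : R) : Type :=
  (torus R * cotF a b)%type.
Definition leaf_vector (R : realType) (a b : R) : lmodType R :=
  (tanF a b * cotF a b)%type.

Definition bundle_proj (R : realType) (a b : R) (q : cotangent a b) :
  torus R := q.1.
Definition dbundle_proj (R : realType) (a b : R) (V : leaf_vector a b) :
  tanF a b := V.1.

Definition cosphere (R : realType) (a b : R) : set (cotangent a b) :=
  [set q | dual_metric q.2 q.2 = 1].

Definition cosphere_leaf (R : realType) (a b : R) (q : cotangent a b) :
  set (cotangent a b) :=
  @cosphere R a b `&` (@bundle_proj R a b @^-1` leaf a b (bundle_proj q)).

(* [velocity c t V]: the curve c in T^*F is differentiable at time t with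
   leafwise velocity V.  The charts of the torus are the local inverses of
   [torus_proj], hence the local lift x; the linear coordinates of the fibre
   are the evaluations at the vectors of TF. *)
Definition velocity (R : realType) (a b : R) (c : R -> cotangent a b) (t : R)
    (V : leaf_vector a b) : Prop :=
  (exists x : R -> 'rV[R]_3,
    (\forall s \near t, torus_proj (x s) = (c s).1) /\
    is_derive t 1 x (vsval V.1)) /\
  (forall v : tanF a b, is_derive t 1 (fun s => (c s).2 v) (V.2 v)).

(* Vectors tangent at q to the leaf S(T^*L) through q. *)
Definition tangent_cosphere_leaf (R : realType) (a b : R)
    (q : cotangent a b) : set (leaf_vector a b) :=
  [set V | exists c : R -> cotangent a b,
    [/\ c 0 = q, (forall s, cosphere_leaf q (c s)) & velocity c 0 V]].

Definition leaf_form (R : realType) (a b : R) : Type :=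
  cotangent a b -> leaf_vector a b -> R.

Definition liouville (R : realType) (a b : R) : leaf_form a b :=
  fun q V => q.2 (dbundle_proj V).

(* The affine structure of the leaves T^*L. *)
Definition translate (R : realType) (a b : R) (q : cotangent a b)
    (V : leaf_vector a b) : cotangent a b :=
  (q.1 + torus_proj (vsval V.1), q.2 + V.2).

(* The exterior derivative along the leaves T^*L, in an affine chart:
   d alpha (X, Y) = X (alpha Y) - Y (alpha X) for constant fields X, Y. *)
Definition leaf_d (R : realType) (a b : R) (alpha : leaf_form a b)
    (q : cotangent a b) (X Y : leaf_vector a b) : R :=
  derive1 (fun s : R => alpha (translate q (s *: X)) Y) 0
  - derive1 (fun s : R => alpha (translate q (s *: Y)) X) 0.

Definition reeb_condition (R : realType) (a b : R) (q : cotangent a b)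
    (V : leaf_vector a b) : Prop :=
  [/\ tangent_cosphere_leaf q V,
      liouville q V = 1 &
      forall Y, tangent_cosphere_leaf q Y -> leaf_d (@liouville R a b) q V Y = 0].

(* On the unit cotangent bundle the Reeb vector exists and is unique; the
   default value 0 is only taken elsewhere. *)
Definition reeb (R : realType) (a b : R) (q : cotangent a b) :
  leaf_vector a b := xget 0 (reeb_condition q).

Definition closed_reeb_orbit (R : realType) (a b : R)
    (c : R -> cotangent a b) : Prop :=
  [/\ forall t, cosphere (c t),
      forall t, velocity c t (reeb (c t)) &
      exists2 T : R, 0 < T & forall t, c (t + T) = c t].

Definition rat_independent (R : realType) (a b : R) : Prop :=
  forall p q r : rat,
    ratr p + ratr q * a + ratr r * b = 0 -> [/\ p = 0, q = 0 & r = 0].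

(* Main.v *)
Require Import Defs.
From mathcomp Require Import all_boot all_order all_algebra.
From mathcomp Require Import generic_quotient ring_quotient.
From mathcomp Require Import all_classical all_reals all_analysis.
From mathcomp Require Import ring lra.

Set Implicit Arguments.
Unset Strict Implicit.
Unset Printing Implicit Defensive.
Import Order.TTheory GRing.Theory Num.Theory.
Import numFieldNormedType.Exports.
Local Open Scope classical_set_scope.
Local Open Scope ring_scope.

(** The metric identifies the covector [w] with the vector [sharp w], and the
    Reeb vector at a point [(p, w)] of the unit cotangent bundle is
    [(sharp w, 0)] ([reebE]): the Reeb flow is the geodesic flow of flat leaves.
    Hence along a Reeb orbit the covector [w] is constant and the base point
    moves on the torus with constant velocity [u = sharp w], a unit vector of
    TF.  If the orbit closes up after time [T], then [T *: u] lies in the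
    lattice Z^3 ([closed_line_period_int]).  It also lies in TF, and the
    rational independence of 1, a, b says that TF meets Z^3 only at the origin
    ([TF_lattice_eq0]).  So [u = 0], which is absurd.

    The Reeb vector is determined from a description of the vectors tangent to
    the leaf of the unit cotangent bundle: [(v, h)] is tangent at [(p, w)] iff
    [h] is orthogonal to [w] ([tangent_cosphere_leafP]).  As the exterior
    derivative of the Liouville form is
    [d lambda ((u, k), (v, h)) = k v - h u] ([leaf_d_liouville]), the kernel of
    its restriction is spanned by [(sharp w, 0)].

    Lifting the projected orbit to R^3 is avoided, because the velocity comes
    with a lift at each time that is only known to be differentiable at that
    time, and these lifts need not fit together.  Instead, the orbit is tested
    against the functions cos (2 pi x_i) and sin (2 pi x_i), which are defined
    on the torus: along [y t - t u], for [y] the projected orbit, they have zero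
    derivative ([periodic_line_const]). *)

(** * One-variable calculus *)

Lemma is_derive_affine (R : realType) (V : normedModType R) (x y : V) (t : R) :
  is_derive t 1 (fun s : R => x + s *: y) y.
Proof.
have lim : (fun h : R => h^-1 *: (((fun s : R => x + s *: y) \o shift t) (h *: 1)
    - (x + t *: y))) @ 0^' --> y.
  apply: cvg_near_cst; near=> h.
  have h0 : h != 0 by near: h; exact: nbhs_dnbhs_neq.
  rewrite /= [h%:A]mulr1 scalerDl opprD addrACA subrr add0r addrK.
  by rewrite scalerA mulVf // scale1r.
by apply: DeriveDef; [apply/cvg_ex; exists y|exact: cvg_lim lim].
Unshelve. all: by end_near. Qed.

Lemma is_derive_mulr (R : realType) (y t : R) :
  is_derive t 1 (fun s : R => s * y) y.
Proof.
by have := is_derive_affine (0 : R^o) (y : R^o) t; under eq_fun do rewrite add0r.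
Qed.

Lemma is_derive_coord (R : realType) (n : nat) (x : R -> 'rV[R]_n) (t : R)
    (u : 'rV[R]_n) (i : 'I_n) :
  is_derive t 1 x u -> is_derive t 1 (fun s => x s 0 i) (u 0 i).
Proof.
move=> [xD xE]; apply: DeriveDef; first by move/derivable_mxP: xD; exact.
by rewrite -xE derive_mx // mxE.
Qed.

(** Fermat's rule when differentiability is known at the maximum only.  Write
    [f z - f t = g z * (z - t)] with [g] continuous at [t] and [g t = d]; moving
    from [t] in the direction [d] would increase [f] if [d] were nonzero. *)
Lemma is_derive_max (R : realType) (f : R -> R) (t d : R) :
  is_derive t 1 f d -> (forall s, f s <= f t) -> d = 0.
Proof.
move=> /is_derive1_caratheodory[g [fE gc gt]] fmax.
apply/eqP; apply: contraT => d0.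
have gd : \forall e \near 0^'+, 0 < g (t + e * d) * d.
  have lc : {for 0, continuous (fun e : R => t + e * d)}.
    apply: cvgD; first exact: cvg_cst.
    by apply: cvgM; [exact: cvg_id|exact: cvg_cst].
  have : g (t + e * d) @[e --> (0 : R)] --> g (t + 0 * d).
    by apply: (continuous_comp lc) => //; rewrite mul0r addr0.
  rewrite mul0r addr0 gt => /(@cvgMr_tmp _ _ _ _ _ _ d).
  move=> /cvgr_gt /(_ 0); rewrite -expr2 exprn_even_gt0 //= d0 => /(_ isT).
  by apply: cvg_within.
have : \forall e \near (0:R)^'+, False.
  near=> e.
  have e0 : 0 < e by near: e; exact: nbhs_right_gt.
  have : 0 < g (t + e * d) * d by near: e.
  have := fE (t + e * d); rewrite addrAC subrr add0r => E.
  have := fmax (t + e * d); rewrite -subr_le0 E => h k.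
  nra.
by case/filter_ex.
Unshelve. all: by end_near. Qed.

(** * Integer periods of the circle functions *)

Section Torus.
Variable R : realType.

Lemma torus_projD (x y : 'rV[R]_3) :
  torus_proj (x + y) = torus_proj x + torus_proj y.
Proof. exact: raddfD. Qed.

Lemma torus_proj_eq (x y : 'rV[R]_3) :
  torus_proj x = torus_proj y -> forall i, x 0 i - y 0 i \is a Num.int.
Proof.
move=> /eqP; rewrite /torus_proj -Quotient.idealrBE => /forallP h i.
by have := h i; rewrite !mxE.
Qed.

Lemma cos_sin_intD (z x : R) : z \is a Num.int ->
  cos (pi *+ 2 * (x + z)) = cos (pi *+ 2 * x) /\
  sin (pi *+ 2 * (x + z)) = sin (pi *+ 2 * x).
Proof.
have per (f : R -> R) n : periodic f (pi *+ 2) ->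
    forall y, f (pi *+ 2 * (y + n%:R)) = f (pi *+ 2 * y).
  by move=> fp y; rewrite mulrDr mulr_natr periodicn.
move=> /intrP[[n|n] ->].
  by rewrite -pmulrn !per //; [exact: sinD2pi|exact: cosD2pi].
rewrite NegzE mulrNz -pmulrn.
have e := subrK n.+1%:R x.
by rewrite -{2 4}e !per //; [exact: sinD2pi|exact: cosD2pi].
Qed.

(** For [y] the fractional part of [x], the duplication formula gives
    sin (pi y) = 0, while the sine is positive on the open interval from 0
    to pi. *)
Lemma cos_2pi_eq1 (x : R) : cos (pi *+ 2 * x) = 1 -> x \is a Num.int.
Proof.
have fl : - (Num.floor x)%:~R \is a @Num.int R by rewrite rpredN intr_int.
move=> /esym; rewrite -(cos_sin_intD x fl).1 => c1.
have y0 : 0 <= x - (Num.floor x)%:~R by rewrite subr_ge0 floor_le_tmp.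
have y1 : x - (Num.floor x)%:~R < 1 by rewrite ltrBlDl -intrD1 floorD1_gt.
move: c1 y0 y1; set y := x - _ => c1 y0 y1.
have sy : sin (pi * y) = 0.
  move: c1; rewrite mulrnAl cos_mulr2n => c1.
  have := cos2Dsin2 (pi * y).
  have -> : cos (pi * y) ^+ 2 = 1 by lra.
  by rewrite -[RHS]addr0 => /addrI /eqP; rewrite sqrf_eq0 => /eqP.
have [y_eq0|yN0] := eqVneq y 0.
  by rewrite -(subrK (Num.floor x)%:~R x) -/y y_eq0 add0r intr_int.
have : 0 < sin (pi * y).
  apply: sin_gt0_pi; rewrite mulr_gt0 ?pi_gt0 ?lt0r ?yN0 //=.
  by rewrite gtr_pMr ?pi_gt0.
by rewrite sy ltxx.
Qed.

End Torus.

(** * The dual metric *)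
Section DualMetric.
Variables (R : realType) (a b : R).
Local Notation tan := (tanF a b).
Local Notation cot := (cotF a b).
Local Notation sharp := (sharp a b).
Implicit Types (u v : tan) (w k : cot).

Lemma flatE u v : flat a b u v = metricF u v.
Proof. by rewrite /flat lfunE /= /flat_fun lfunE. Qed.

Lemma metricFC u v : metricF u v = metricF v u.
Proof. by apply: eq_bigr => i _; rewrite mulrC. Qed.

Lemma metricF_ge0 u : 0 <= metricF u u.
Proof. by apply: sumr_ge0 => i _; rewrite -expr2 sqr_ge0. Qed.

Lemma metricF_eq0 u : metricF u u = 0 -> u = 0.
Proof.
move=> /eqP; rewrite psumr_eq0 => [/allP u0|i _]; last by rewrite -expr2 sqr_ge0.
apply: val_inj; apply/rowP => i; rewrite mxE.
by have := u0 i (mem_index_enum _); rewrite mulf_eq0 orbb => /eqP.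
Qed.

Lemma lker_flat : lker (flat a b) == 0%VS.
Proof.
apply/lker0P => u v e; apply/eqP; rewrite -subr_eq0; apply/eqP.
apply: metricF_eq0.
have fuv : flat a b (u - v) = 0 by rewrite linearB /= e subrr.
by rewrite -flatE fuv lfunE.
Qed.

(** [flat] is onto, being injective between spaces of equal dimension. *)
Lemma sharpK w : flat a b (sharp w) = w.
Proof.
apply: limg_lfunVK; suff -> : limg (flat a b) = fullv by exact: memvf.
apply/eqP; rewrite eqEdim subvf limg_dim_eq ?(eqP lker_flat) ?capv0 //=.
by rewrite !dimvf /dim /= muln1.
Qed.

Lemma metric_sharp w v : metricF (sharp w) v = w v.
Proof. by rewrite -flatE sharpK. Qed.

Lemma sharp_flat u : sharp (flat a b u) = u.
Proof. exact: lker0_lfunK lker_flat u. Qed.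

Lemma dual_metricE w k : dual_metric w k = w (sharp k).
Proof. exact: metric_sharp. Qed.

Lemma pairing_sharpC w k : w (sharp k) = k (sharp w).
Proof. by rewrite -!metric_sharp metricFC. Qed.

(** The Cauchy-Schwarz inequality for unit covectors, from the expansion of
    the square norm of [sharp w - sharp k]. *)
Lemma unit_pairing_le1 w k : dual_metric w w = 1 -> dual_metric k k = 1 ->
  k (sharp w) <= 1.
Proof.
rewrite !dual_metricE => w1 k1.
have := metricF_ge0 (sharp w - sharp k).
rewrite -linearB metric_sharp add_lfunE opp_lfunE linearB !raddfB /=.
by rewrite w1 k1 (pairing_sharpC w k); lra.
Qed.
End DualMetric.

(** * The Reeb vector *)
Section Reeb.
Variables (R : realType) (a b : R).
Local Notation sharp := (sharp a b).

Lemma leaf_d_liouville (q : cotangent a b) (X Y : leaf_vector a b) :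
  leaf_d (@liouville R a b) q X Y = X.2 Y.1 - Y.2 X.1.
Proof.
have D (h : cotF a b) v : derive1 (fun s : R => (q.2 + s *: h) v : R) 0 = h v.
  rewrite derive1E; apply: derive_val.
  have -> : (fun s : R => (q.2 + s *: h) v : R) = fun s => (q.2 v : R^o) + s *: h v.
    by apply/funext => s; rewrite add_lfunE scale_lfunE.
  exact: is_derive_affine.
by rewrite /leaf_d /liouville /translate /dbundle_proj /= !D.
Qed.

(** If [c] is a curve of unit covectors through [w], then [s |-> c s (sharp w)]
    is at most 1 by Cauchy-Schwarz, with equality at [w]; so its derivative
    [V.2 (sharp w)] vanishes.  Conversely, given [V.2] orthogonal to [w], the
    base point moves along a line and the covector along the rational
    parametrisation of the circle spanned by [w] and [V.2], which is defined
    with the square norm of [V.2] alone and also covers the case [V.2 = 0]. *)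
Lemma tangent_cosphere_leafP (q : cotangent a b) (V : leaf_vector a b) :
  cosphere q -> tangent_cosphere_leaf q V <-> V.2 (sharp q.2) = 0.
Proof.
move=> q1; split=> [[c [c0 cS [_ cV]]]|V0].
  have /is_derive_max := cV (sharp q.2); apply=> s.
  rewrite c0 -[leRHS](dual_metricE q.2) q1.
  by apply: unit_pairing_le1 => //; have [] := cS s.
(* With |V.2|^2 = 4 Q and w orthogonal to V.2 of norm 1, the square norm of
   (1 - s^2 Q) w + s V.2 is (1 - s^2 Q)^2 + 4 s^2 Q = (1 + s^2 Q)^2. *)
pose Q : R := V.2 (sharp V.2) / 4.
pose den (s : R) : R := 1 + s ^+ 2 * Q.
pose num (s : R) : cotF a b := (1 - s ^+ 2 * Q) *: q.2 + s *: V.2.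
exists (fun s : R => (q.1 + torus_proj (s *: vsval V.1), (den s)^-1 *: num s)).
split.
- rewrite /den /num expr0n /= mul0r addr0 subr0 invr1 !scale1r !scale0r addr0.
  by rewrite /torus_proj raddf0 addr0; case: (q).
- move=> s; split; last by exists (s *: V.1).
  have wQ : q.2 (sharp q.2) = 1 by rewrite -dual_metricE.
  have wV : q.2 (sharp V.2) = 0 by rewrite pairing_sharpC.
  have VQ : V.2 (sharp V.2) = 4 * Q by rewrite /Q; field.
  have Q0 : 0 <= Q.
    by rewrite divr_ge0 // -dual_metricE; exact: metricF_ge0.
  have d0 : 1 + s ^+ 2 * Q != 0 by rewrite gt_eqF //; nra.
  rewrite /cosphere /= dual_metricE /num scale_lfunE add_lfunE !scale_lfunE.
  rewrite !linearZ /= !linearD !linearZ /= wQ wV V0 VQ /den.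
  by rewrite /GRing.scale /=; field.
- split=> /=.
    exists (fun s => repr q.1 + s *: vsval V.1); split.
      apply: filterE => s; rewrite torus_projD; congr (_ + _).
      exact: reprK.
    exact: is_derive_affine.
  move=> v.
  have -> : (fun s => ((den s)^-1 *: num s) v) =
      (fun s => (den s)^-1) * ((cst 1 - id ^+ 2 * cst Q) * cst (q.2 v : R)
        + id * cst (V.2 v : R)).
    by apply/funext => s; rewrite scale_lfunE /num add_lfunE !scale_lfunE.
  have Dden : is_derive (0 : R) 1 den 0.
    have -> : den = cst 1 + id ^+ 2 * cst Q by [].
    apply: is_derive_eq; rewrite /GRing.scale /= expr1; ring.
  have den0 : den 0 = 1 by rewrite /den expr0n mul0r addr0.
  have Dinv := is_deriveV _ Dden; rewrite den0 in Dinv.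
  have {}Dinv := Dinv (oner_neq0 R).
  apply: is_derive_eq; rewrite /GRing.scale /= !fctE /= den0.
  by rewrite expr0n !mul0r; field.
Qed.

(** Existence and uniqueness.  For a vector [(u, h)] satisfying the Reeb
    condition, testing [d lambda] on the tangent vectors [(v, 0)] gives [h = 0],
    and testing on [(0, k)] with [k] orthogonal to [w] shows that [u] is
    proportional to [sharp w]; [lambda = 1] fixes the factor. *)
Lemma reebE (q : cotangent a b) : cosphere q -> reeb q = (sharp q.2, 0).
Proof.
move=> q1; have qq : q.2 (sharp q.2) = 1 by rewrite -dual_metricE.
have ex : reeb_condition q (sharp q.2, 0).
  split => //; first by apply/tangent_cosphere_leafP; rewrite //= lfunE.
  move=> Y /(tangent_cosphere_leafP _ q1) Y0.
  by rewrite leaf_d_liouville /= Y0 lfunE subrr.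
rewrite /reeb.
case: (xgetP 0 (reeb_condition q)) => [[u h] _ [_ lu dV]|noV]; last first.
  by case: (noV _ ex).
have h0 : h = 0.
  apply/lfunP => v; rewrite lfunE.
  have /dV : tangent_cosphere_leaf q (v, 0).
    by apply/tangent_cosphere_leafP; rewrite //= lfunE.
  by rewrite leaf_d_liouville /= lfunE subr0.
congr pair => //; apply/eqP; rewrite -subr_eq0; apply/eqP; apply: metricF_eq0.
(* [lambda = 1] makes [x := u - sharp w] orthogonal to [sharp w], so that the
   covector dual to [x] itself is an admissible [k]. *)
set x := u - _; pose k := flat a b x.
have kq : k (sharp q.2) = 0.
  by rewrite pairing_sharpC sharp_flat linearB /= qq (lu : q.2 u = 1) subrr.
have /dV : tangent_cosphere_leaf q (0, k) by apply/tangent_cosphere_leafP.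
rewrite leaf_d_liouville /= h0 lfunE sub0r => /eqP; rewrite oppr_eq0 => /eqP ku.
by rewrite -flatE {2}/x linearB /= -/k ku kq subrr.
Qed.
End Reeb.

(** * Closed lines and closed Reeb orbits *)

(** A 1-periodic function [F] of a coordinate is a function on the torus, so any
    lifts may be used to compute it: the representatives [repr (y s)], which may
    jump, and the local lifts, which are differentiable one point at a time. *)
Lemma periodic_line_const (R : realType) (F F' : R -> R)
    (y : R -> torus R) (u : 'rV[R]_3) (i : 'I_3) :
  (forall s z, z \is a Num.int -> F (s + z) = F s) ->
  (forall s : R, is_derive s 1 F (F' s)) ->
  (forall t, exists x : R -> 'rV[R]_3,
    (\forall s \near t, torus_proj (x s) = y s) /\ is_derive t 1 x u) ->
  forall s t, F (repr (y s) 0 i - s * u 0 i) = F (repr (y t) 0 i - t * u 0 i).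
Proof.
move=> Fper FD yD s t.
apply: (@is_derive_0_is_cst _ (fun s => F (repr (y s) 0 i - s * u 0 i))) => {s t} t.
have [x [xy xD]] := yD t.
have Dx : is_derive t 1 (fun s => x s 0 i - s * u 0 i) 0.
  rewrite -(subrr (u 0 i)); apply: is_deriveB; first exact: is_derive_coord.
  exact: is_derive_mulr.
have DF : is_derive t 1 (F \o (fun s => x s 0 i - s * u 0 i)) 0.
  by apply: is_derive_eq; last exact: mulr0.
apply: near_eq_is_derive DF.
near=> s => /=.
have xys : torus_proj (repr (y s)) = torus_proj (x s).
  by rewrite /torus_proj reprK; symmetry; near: s.
rewrite -(Fper (x s 0 i - s * u 0 i) _ (torus_proj_eq xys i)); congr F; ring.
Unshelve. all: by end_near. Qed.

(** Apply the preceding lemma to cos (2 pi x) and sin (2 pi x) and let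
    [A = 2 pi (y 0)_i], [B = A - 2 pi T u_i]: then cos A = cos B and
    sin A = sin B, so that cos (A - B) = 1. *)
Lemma closed_line_period_int (R : realType) (y : R -> torus R) (u : 'rV[R]_3) (T : R) :
  (forall t, exists x : R -> 'rV[R]_3,
    (\forall s \near t, torus_proj (x s) = y s) /\ is_derive t 1 x u) ->
  y T = y 0 -> forall i, T * u 0 i \is a Num.int.
Proof.
move=> yD yT i; apply: cos_2pi_eq1.
have D (F F' : R -> R) : (forall s : R, is_derive s 1 F (F' s)) ->
    forall s : R, is_derive s 1 (fun s => F (pi *+ 2 * s))
      (F' (pi *+ 2 * s) * (pi *+ 2)).
  move=> FD s; apply: (@is_derive1_comp _ F (fun s => pi *+ 2 * s)).
  by under eq_fun do rewrite mulrC; exact: is_derive_mulr.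
have C := periodic_line_const i (fun s z zi => (cos_sin_intD s zi).1)
  (D _ _ (@is_derive_cos R)) yD T 0.
have S := periodic_line_const i (fun s z zi => (cos_sin_intD s zi).2)
  (D _ _ (@is_derive_sin R)) yD T 0.
move: C S; rewrite yT mul0r subr0; move: (repr (y 0)) => r C S.
have -> : pi *+ 2 * (T * u 0 i) =
  pi *+ 2 * r 0 i - pi *+ 2 * (r 0 i - T * u 0 i) by ring.
by rewrite cosB C S -!expr2 cos2Dsin2.
Qed.

(** An integer vector of TF is a rational relation v_2 - a v_0 - b v_1 = 0
    between 1, a and b; this is why the leaves are planes. *)
Lemma TF_lattice_eq0 (R : realType) (a b : R) (v : 'rV[R]_3) :
  rat_independent a b -> v \in TF a b -> (forall i, v 0 i \is a Num.int) ->
  v = 0.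
Proof.
move=> hab; rewrite memv_ker add_lfunE add_lfunE !opp_lfunE !scale_lfunE !lfunE /=.
rewrite /dcoord_fun => /eqP e vZ.
have /intrP[n0 e0] := vZ 0; have /intrP[n1 e1] := vZ 1.
have /intrP[n2 e2] := vZ 2.
have [] := hab n2%:~R (- n0%:~R) (- n1%:~R).
  rewrite !rmorphN /= !ratr_int -e0 -e1 -e2 -[RHS]e /GRing.scale /=; ring.
move=> z2 /eqP; rewrite oppr_eq0 => /eqP z0 /eqP; rewrite oppr_eq0 => /eqP z1.
have Z n : n%:~R = 0 :> rat -> n%:~R = 0 :> R.
  by move=> /eqP; rewrite intr_eq0 => /eqP ->.
apply/rowP => i; rewrite mxE.
have : i \in [:: 0; 1; 2 : 'I_3] by case: i => [[|[|[|]]]].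
by rewrite !inE => /or3P[] /eqP ->; rewrite ?e0 ?e1 ?e2; exact: Z.
Qed.

Theorem proposition23 (R : realType) (a b : R) (hab : rat_independent a b) :
  ~ exists c : R -> cotangent a b, closed_reeb_orbit c.
Proof.
move=> [c [cS cV [T T0 cT]]].
have {}cV t : velocity c t (sharp a b (c t).2, 0) by rewrite -reebE.
have w_const t : (c t).2 = (c 0).2.
  apply/lfunP => v.
  apply: (@is_derive_0_is_cst _ (fun s => (c s).2 v : R)) => s.
  by have [_ /(_ v)] := cV s; rewrite lfunE.
set u := sharp a b (c 0).2.
have Tu : T *: vsval u = 0.
  apply: (TF_lattice_eq0 hab) => [|i]; first by rewrite memvZ // subvsP.
  rewrite mxE; apply: (@closed_line_period_int _ (fun t => (c t).1)) => [t|].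
    by have [] := cV t; rewrite w_const.
  by rewrite -[T]add0r cT.
have u0 : u = 0.
  by apply: val_inj; move/eqP: Tu; rewrite scaler_eq0 gt_eqF //= => /eqP.
have := cS 0; rewrite /cosphere /= dual_metricE -/u u0 linear0 => /eqP.
by rewrite eq_sym oner_eq0.
Qed.
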